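(* Let $d\ge0$ and consider the Gaussian broadcast model on $P=\mathbb{Z}_{\ge0}^{d+1}$ in the critical case $\alpha_i=1/i$ for all $i\in\{1,\dots,d+1\}$. There is a constant $K_d>0$ depending only on $d$ such that for every integer $t\ge1$ and every choice of reals $c_u\ge0$ ($u\in L_t$) with $\sum_{u\in L_t}c_u>0$, the random variable $\zeta=\sum_{u\in L_t}c_uX_u$ satisfies $$\frac{\operatorname{Cov}(\zeta,X_0)}{\sqrt{\operatorname{Var}(\zeta)}}\le \frac{K_d}{t^{1/4}}.$$
   Context: Gaussian broadcast model: Let $d\ge 0$ and let $P$ be an infinite graded poset with layers $L_0,L_1,\dots$ ($L_t$ = elements of rank $t$, $L_0$ = minimal elements), in which every element covers at most $d+1$ elements. For $v\in P$ let $\mathfrak p(v)$ be the set of elements covered by $v$. Given $\alpha_1,\dots,\alpha_{d+1}>0$, let $X_0\sim\mathcal N(0,1)$ and, independently, let $W_{u\to v}$ be i.i.d. $\mathcal N(0,1)$ indexed by covering pairs $u\lessdot v$. Set $X_v=X_0$ for $v\in L_0$, and for $v$ of rank $\ge1$ set $X_v=\alpha_{|\mathfrak p(v)|}\sum_{u\in\mathfrak p(v)}(X_u+W_{u\to v})$. Finite model: $P=\mathbb{Z}_{\ge0}^{d+1}$ with $u\le v$ iff $v-u\in\mathbb{Z}_{\ge0}^{d+1}$; $L_t$ is the set of tuples with coordinate sum $t$; $|\mathfrak p(v)|$ equals the number of positive coordinates of $v$. *)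

(* Defs.v *)
From HB Require Import structures.
From mathcomp Require Import all_boot all_order all_algebra.
From mathcomp Require Import all_classical all_reals all_analysis.
Set Implicit Arguments. Unset Strict Implicit. Unset Printing Implicit Defensive.
Import Order.TTheory GRing.Theory Num.Theory.
Local Open Scope classical_set_scope.
Local Open Scope ring_scope.

Definition vtx (d : nat) := {ffun 'I_d.+1 -> nat}.

Definition rank d (v : vtx d) : nat := (\sum_(i < d.+1) v i)%N.

(* v - e_i (only meaningful when v i > 0) *)
Definition vsub d (v : vtx d) (i : 'I_d.+1) : vtx d :=
  [ffun j => if j == i then (v j).-1 else v j].

Definition npos d (v : vtx d) : nat := #|[pred i : 'I_d.+1 | (0 < v i)%N]|.

Definition layer d (t : nat) : seq (vtx d) :=
  map (fun u : {ffun 'I_d.+1 -> 'I_t.+1} => [ffun i => nat_of_ord (u i)] : vtx d)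
    (seq.filter (fun u : {ffun 'I_d.+1 -> 'I_t.+1} =>
               (\sum_(i < d.+1) (u i : nat))%N == t)
       (enum {ffun 'I_d.+1 -> 'I_t.+1})).

(* Index set of the driving noise: None = X_0, Some (u,i) = W_{u -> u + e_i}. *)
Definition noise_idx d := option (vtx d * 'I_d.+1).

(* Gaussian broadcast model with weights alpha, on Z_{>=0}^{d+1}.
   bcast alpha G t v is X_v for v of rank t (computed by recursion on rank);
   X_0 = G None, W_{u -> v} = G (Some (u, i)) where v = u + e_i. *)
Fixpoint bcast {T : Type} {R : realType} d (alpha : nat -> R)
    (G : noise_idx d -> T -> R) (t : nat) (v : vtx d) : T -> R :=
  match t with
  | 0 => G None
  | t'.+1 => fun w => alpha (npos v) *
      \sum_(i < d.+1 | (0 < v i)%N)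
         (bcast alpha G t' (vsub v i) w + G (Some (vsub v i, i)) w)
  end.

Definition Xv {T : Type} {R : realType} d (alpha : nat -> R)
    (G : noise_idx d -> T -> R) (v : vtx d) : T -> R :=
  bcast alpha G (rank v) v.

Definition alpha_crit {R : realType} (k : nat) : R := (k%:R)^-1.

Definition mutually_independent {dsp} {T : measurableType dsp} {R : realType}
    (P : probability T R) (I : eqType) (Y : I -> T -> R) : Prop :=
  forall (J : seq I) (B : I -> set R),
    uniq J -> (forall i, measurable (B i)) ->
    P (\big[setI/setT]_(i <- J) (Y i @^-1` B i)) =
    (\prod_(i <- J) P (Y i @^-1` B i))%E.

Definition std_normal {dsp} {T : measurableType dsp} {R : realType}
    (P : probability T R) (Y : T -> R) : Prop :=
  measurable_fun setT Y /\
  forall B : set R, measurable B -> P (Y @^-1` B) = normal_prob 0 1 B.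

(* Main.v *)
Require Import Defs.
From HB Require Import structures.
From mathcomp Require Import all_boot all_order all_algebra.
From mathcomp Require Import all_classical all_reals all_analysis.
From mathcomp Require Import measurable_realfun ring lra zify.
Import Order.TTheory GRing.Theory Num.Theory.
Local Open Scope classical_set_scope.
Local Open Scope ring_scope.

(* Unrolling the recursion, [X_u = X_0 + sum_e p_u(e) W_e], where [p_u(e)] is the
   probability that the walk stepping from [u] to a uniformly chosen covered
   element traverses the edge [e].  Hence, up to the common variance of the noise,
   [Cov(zeta, X_0) = C := sum c_u] and [Var(zeta)] is [C^2] plus the sum over [e]
   of [(sum_u c_u p_u(e))^2], and it suffices to find order [sqrt t] edges carrying
   mass of order [C].  These are the edges [k e_i -> (k+1) e_i] on the axes, for
   [k] up to a small multiple of [sqrt t]: a coordinate stays at zero once it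
   gets there, and with probability bounded below all coordinates but a largest
   one, [v_i], vanish before [v_i] decreases to [k].  Indeed
   [prod_(j <> i) race (v_i - k) (v_j)], where [race a b] is the probability that
   [b] vanishes before [a] when a fair coin decides which of the two decreases,
   is subharmonic for the walk, and [race (m - k) m] is bounded below when
   [k <= sqrt m / 10], by comparison with a quartic martingale. *)

(** * The race of two coordinates *)

(** The tie [race 0 0] counts as a win, so [race a 0 = 1] for every [a]. The inner fixpoint keeps
    both recursive calls structural. *)
Fixpoint race {R : realFieldType} (a b : nat) : R :=
  match a with
  | 0 => (b == 0)%:R
  | a'.+1 => (fix race_a b := match b with
                | 0 => 1
                | b'.+1 => (race a' b'.+1 + race_a b') / 2
              end) b
  end.
Arguments race : simpl never.

Section Race.
Variable R : realFieldType.
Implicit Types a b k m : nat.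
Local Notation race := (@race R).

Lemma race0n b : race 0 b = (b == 0)%:R. Proof. by []. Qed.

Lemma racen0 a : race a 0 = 1. Proof. by case: a. Qed.

Lemma raceSS a b : race a.+1 b.+1 = (race a b.+1 + race a.+1 b) / 2.
Proof. by []. Qed.

Lemma race_ge0 a b : 0 <= race a b.
Proof.
elim: a b => [|a IHa] b; first by rewrite race0n.
elim: b => [|b IHb]; first by rewrite racen0.
by rewrite raceSS divr_ge0 // addr_ge0.
Qed.

Lemma race_gt0 a b : 0 < race a.+1 b.
Proof.
elim: b => [|b IHb]; first by rewrite racen0.
by rewrite raceSS divr_gt0 // ltr_wpDl // race_ge0.
Qed.

Lemma race_le_succl a b : race a b <= race a.+1 b.
Proof.
elim: a b => [|a IHa] b; first by case: b => [|b]; rewrite ?racen0 // race0n race_ge0.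
elim: b => [|b IHb]; first by rewrite !racen0.
by rewrite (raceSS a.+1) (raceSS a) ler_pM2r ?invr_gt0 // lerD // IHa.
Qed.

(** By [raceSS] the value at [(a+1, b+1)] is the mean of those at [(a, b+1)] and [(a+1, b)]; being
    at least the first, it is at most the second. *)
Lemma race_le_succr a b : race a b.+1 <= race a b.
Proof.
case: a => [|a]; first by rewrite !race0n.
have := race_le_succl a b.+1; rewrite raceSS; lra.
Qed.

Lemma race_antitone a b b' : (b <= b')%N -> race a b' <= race a b.
Proof.
move=> /subnK <-; elim: (b' - b)%N => // n IHn.
by rewrite addSn (le_trans (race_le_succr _ _)).
Qed.

Lemma race_le1 a b : race a b <= 1.
Proof. by rewrite -(racen0 a) race_antitone. Qed.

(* The left-hand side is [L^4] times [D / L + (D / L)^2 - (D / L)^4] corrected by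
   terms in [r] into a martingale of the walk; it is nonpositive on [a = 0] and at
   most [2 L^4] on [b = 0]. *)
Lemma race_ge_quartic (L : R) a b : 2 <= L ->
  let D := a%:R - b%:R in let r := a%:R + b%:R in
  L ^+ 3 * D + L ^+ 2 * (D ^+ 2 + r)
    - (D ^+ 4 + 6 * D ^+ 2 * r + 3 * r ^+ 2 - 2 * r) <= 2 * L ^+ 4 * race a b.
Proof.
move=> L2 /=; elim: a b => [|a IHa] b.
  case: b => [|b]; first by rewrite racen0 !(expr0n, subr0, addr0, mulr0) /=; nra.
  rewrite race0n mulr0 sub0r add0r.
  set y : R := b.+1%:R; have y1 : 1 <= y by rewrite /y ler1n.
  have h1 : 0 <= (L - 2) * L ^+ 2 by rewrite mulr_ge0 ?sqr_ge0 ?subr_ge0.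
  (* This cubic expands to [y^3 - 27/25 L^2 y + 54/125 L^3], so it absorbs [- L^2 y]; [h1] absorbs
     [- L^2] with half of [L^3]. *)
  have h2 : 0 <= (y - 3 / 5 * L) ^+ 2 * (y + 6 / 5 * L).
    by rewrite mulr_ge0 ?sqr_ge0 //; lra.
  have h3 : 0 <= L ^+ 3 by rewrite exprn_ge0 //; lra.
  have h4 : 0 <= L ^+ 2 * y by rewrite mulr_ge0 ?sqr_ge0 //; lra.
  have h5 : 0 <= L ^+ 3 - L ^+ 2 * y - L ^+ 2 + y ^+ 3 + 6 * y ^+ 2 + 3 * y - 2.
    by nra.
  have : 0 <= y * (L ^+ 3 - L ^+ 2 * y - L ^+ 2 + y ^+ 3 + 6 * y ^+ 2 + 3 * y - 2).
    by rewrite mulr_ge0 //; lra.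
  lra.
elim: b => [|b IHb].
  rewrite racen0 mulr1 subr0 addr0.
  set y : R := a.+1%:R; have y1 : 1 <= y by rewrite /y ler1n.
  have h1 : 0 <= (L - 2) * (L ^+ 2 * y).
    by rewrite !mulr_ge0 ?sqr_ge0 ?subr_ge0 //; lra.
  (* After [h1], these squares give [3/2 L^3 y + L^2 y^2 - y^4 <= 25/16 L^4], within the allowed
     [2 L^4]. *)
  have h2 := sqr_ge0 (y ^+ 2 - L ^+ 2).
  have h3 := sqr_ge0 (L * (y - 3 / 4 * L)).
  have h4 := sqr_ge0 (L ^+ 2).
  have h5 : 0 <= y ^+ 3 by rewrite exprn_ge0 //; lra.
  nra.
rewrite raceSS; have := IHa b.+1; move: IHb.
rewrite -!(natr1 a) -!(natr1 b). set A : R := a%:R; set B : R := b%:R.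
set x := race _ _; set y := race _ _ => ha hb.
lra.
Qed.

(** Evaluate the quartic bound at [D = - k], [r = L^2 / 8 - k]: the leading part is
    [L^4 / 8 - 3 L^4 / 64 = 5 L^4 / 64], of which [- L^3 k] costs at most [L^4 / 40]. At least
    [L^4 / 25] survives the lower-order terms, whence the factor 1/50. *)
Lemma race_ge_near_diagonal (L : R) k m :
  2 <= L -> L ^+ 2 = 16 * m%:R -> 40 * k%:R <= L -> 50^-1 <= race (m - k)%N m.
Proof.
move=> L2 Lm kL; have [km|mk] := leqP k m; last first.
  have : k%:R >= m%:R + 1 :> R by rewrite natr1 ler_nat.
  have : 0 <= m%:R :> R by [].
  nra.
have := race_ge_quartic L (m - k)%N m L2; rewrite /= natrB //.
have -> : m%:R = L ^+ 2 / 16 :> R by rewrite Lm; field.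
have : 0 <= k%:R :> R by [].
set x : R := k%:R in kL *; set g := race _ _ => x0.
set z := (X in X <= _ -> _).
have L4 : 0 < L ^+ 4 by rewrite exprn_gt0 //; lra.
suff hz : L ^+ 4 / 25 <= z by move=> hg; rewrite -(ler_pM2l L4); lra.
have x3 : 0 <= x ^+ 3 by rewrite exprn_ge0.
have h1 : 0 <= (L - 40 * x) * L ^+ 3.
  by rewrite mulr_ge0 ?exprn_ge0 //; lra.
have h2 : 0 <= (L - 40 * x) * L ^+ 2 by rewrite mulr_ge0 ?sqr_ge0 ?subr_ge0.
have h3 : 0 <= (L - 2) * L ^+ 3 by rewrite mulr_ge0 ?exprn_ge0 //; lra.
have h4 : 0 <= (L ^+ 2 / 4 - x ^+ 2) * x ^+ 2 by rewrite mulr_ge0 ?sqr_ge0 //; nra.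
have h5 : 0 <= L ^+ 2 / 4 - 2 * x - 3 * x ^+ 2 by nra.
have h6 : 0 <= L ^+ 4 by rewrite exprn_ge0 //; lra.
rewrite {}/z; lra.
Qed.
End Race.

(** * Reaching an axis *)

(** Weierstrass product inequality. The induction carries along that the product lies in [[0, 1]],
    which its step needs. *)
Lemma bernoulli_prod (R : realDomainType) (I : finType) (P : pred I) (x : I -> R) :
  (forall i, P i -> 0 <= x i <= 1) ->
  1 - \sum_(i | P i) (1 - x i) <= \prod_(i | P i) x i.
Proof.
move=> x01; have [] // : 1 - \sum_(i | P i) (1 - x i) <= \prod_(i | P i) x i
  /\ 0 <= \prod_(i | P i) x i <= 1.
elim/big_rec2: _ => [|i y1 y2 /x01 /andP[xi0 xi1] [IH /andP[y0 y1']]].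
  by rewrite subr0 lexx ler01.
split; last by rewrite mulr_ge0 // mulr_ile1.
nra.
Qed.

(** Treats the races of [v_i - k] against the other coordinates as if they were independent.
    Truncated subtraction makes the product vanish when [v_i <= k] while another coordinate is
    positive. *)
Definition corner_bound {R : realFieldType} d (k : nat) (i : 'I_d.+1) (v : vtx d) : R :=
  \prod_(j | j != i) race (v i - k) (v j).

Section CornerBound.
Variables (R : realFieldType) (d : nat).
Implicit Types (k : nat) (i j : 'I_d.+1) (v : vtx d).
Local Notation corner_bound := (@corner_bound R d).

Lemma rank_vsub v i : (0 < v i)%N -> rank v = (rank (vsub v i)).+1.
Proof.
move=> vi; rewrite /rank (bigD1 i) //= [in RHS](bigD1 i) //= ffunE eqxx.
rewrite -addSn prednK //; congr addn; apply: eq_bigr => j /negbTE ji.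
by rewrite ffunE ji.
Qed.

Lemma leq_coord_rank v i : (v i <= rank v)%N.
Proof. by rewrite /rank (bigD1 i) //= leq_addr. Qed.

Lemma exists_pos_other v i : (v i < rank v)%N -> exists2 j, j != i & (0 < v j)%N.
Proof.
rewrite /rank (bigD1 i) //= -[X in (X < _)%N]addn0 ltn_add2l lt0n.
by rewrite sum_nat_eq0 => /forall_inPn[j ji v0]; exists j; rewrite // lt0n.
Qed.

Lemma corner_bound_ge0 k i v : 0 <= corner_bound k i v.
Proof. by apply: prodr_ge0 => j _; apply: race_ge0. Qed.

Lemma corner_bound_le1 k i v : corner_bound k i v <= 1.
Proof. by apply: prodr_ile1 => j _; rewrite race_ge0 race_le1. Qed.

Lemma corner_bound_eq0 k i v :
  (v i <= k)%N -> (v i < rank v)%N -> corner_bound k i v = 0.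
Proof.
move=> vik /exists_pos_other[j ji vj].
rewrite /corner_bound (bigD1 j) //= (eqP (_ : v i - k == 0)%N) ?subn_eq0 //.
by rewrite race0n gtn_eqF // mul0r.
Qed.

(* Dividing by [corner_bound k i v], the claim reduces through [raceSS] to
   [prod rho_j >= 1 - sum (1 - rho_j)], where
   [rho_j = race (v i - k - 1) (v j) / race (v i - k) (v j)]. *)
Lemma corner_bound_subharmonic k i v : (k.+1 < rank v)%N ->
  corner_bound k i v <=
    (npos v)%:R^-1 * \sum_(j | (0 < v j)%N) corner_bound k i (vsub v j).
Proof.
move=> kv; have [vik|kvi] := leqP (v i) k.
  rewrite corner_bound_eq0 ?(leq_ltn_trans vik) // 1?ltnW //.
  by rewrite mulr_ge0 ?invr_ge0 // sumr_ge0 // => j _; apply: corner_bound_ge0.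
have vi : (0 < v i)%N by apply: leq_ltn_trans kvi.
have [a vika] : exists a, (v i - k = a.+1)%N.
  by exists (v i - k).-1; rewrite prednK // subn_gt0.
pose rho j : R := race a (v j) / race a.+1 (v j).
have rho01 j : j != i -> 0 <= rho j <= 1.
  move=> _; rewrite divr_ge0 ?race_ge0 //=.
  by rewrite ler_pdivrMr ?race_gt0 // mul1r race_le_succl.
have hE : corner_bound k i v = \prod_(j | j != i) race a.+1 (v j).
  by rewrite /corner_bound vika.
have hi : corner_bound k i (vsub v i) = corner_bound k i v * \prod_(j | j != i) rho j.
  rewrite hE -big_split /=; apply: eq_bigr => j ji.
  rewrite !ffunE eqxx (negbTE ji) mulrC divfK ?gt_eqF ?race_gt0 //.
  by congr race; lia.
(* Solving [raceSS] for the value with [v j] decreased gives the factor [2 - rho j]. *)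
have hj j : j != i -> (0 < v j)%N ->
    corner_bound k i (vsub v j) = corner_bound k i v * (2 - rho j).
  move=> ji vj; rewrite hE (bigD1 j) //= /corner_bound (bigD1 j) //=.
  rewrite mulrAC; congr (_ * _); last first.
    apply: eq_bigr => l /andP[li lj].
    by rewrite !ffunE (negbTE lj) eq_sym (negbTE ji) vika.
  rewrite !ffunE eqxx eq_sym (negbTE ji) vika /rho.
  case: (v j) vj => // b _; rewrite succnK mulrBr mulrCA mulfV ?gt_eqF ?race_gt0 //.
  by rewrite mulr1 raceSS; field.
rewrite (bigD1 i) //= hi.
rewrite [X in _ + X](eq_bigr (fun j => corner_bound k i v * (2 - rho j))); last first.
  by move=> j /andP[vj ji]; rewrite hj.
rewrite -mulr_sumr -mulrDr mulrCA ler_peMr ?corner_bound_ge0 //.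
have np : (npos v)%:R = 1 + \sum_(j | (0 < v j)%N && (j != i)) 1 :> R.
  by rewrite /npos -sum1_card natr_sum (bigD1 i).
have np0 : 0 < (npos v)%:R :> R.
  by rewrite np ltr_pwDl // sumr_ge0.
rewrite ler_pdivlMl // mulr1 np.
have := bernoulli_prod R _ (fun j => j != i) rho rho01.
(* A coordinate at zero has [rho j = 1] and adds nothing, so the Weierstrass sum runs over the
   available moves only. *)
rewrite (bigID (fun j => (0 < v j)%N)) /= [X in _ - (_ + X) <= _]big1 ?addr0; last first.
  by move=> j /andP[_]; rewrite -eqn0Ngt => /eqP vj; rewrite /rho vj !racen0 divr1 subrr.
under eq_bigl do rewrite andbC.
have -> : \sum_(j | (0 < v j)%N && (j != i)) (2 - rho j) =
   \sum_(j | (0 < v j)%N && (j != i)) 1 + \sum_(j | (0 < v j)%N && (j != i)) (1 - rho j).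
  by rewrite -big_split /=; apply: eq_bigr => j _; ring.
lra.
Qed.
End CornerBound.

(** * Noise coefficients of the broadcast *)

Lemma mem_layer d t (u : vtx d) : (u \in layer d t) = (rank u == t).
Proof.
apply/mapP/eqP => [[f] | ut].
  rewrite mem_filter => /andP[/eqP ft _] ->; apply: etrans ft.
  by apply: eq_bigr => i _; rewrite ffunE.
have ui i : (u i < t.+1)%N by rewrite ltnS -ut leq_coord_rank.
exists [ffun i => Ordinal (ui i)]; last by apply/ffunP => i; rewrite !ffunE.
rewrite mem_filter mem_enum andbT; apply/eqP; apply: etrans ut.
by apply: eq_bigr => i _; rewrite ffunE.
Qed.

Section BroadcastRecursion.
Variables (R : realType) (T : Type) (d : nat) (alpha : nat -> R).
Implicit Types (G : noise_idx d -> T -> R) (v : vtx d).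

Lemma Xv_rank0 G v w : rank v = 0 -> Xv alpha G v w = G None w.
Proof. by rewrite /Xv => ->. Qed.

Lemma Xv_rec G v w : (0 < rank v)%N ->
  Xv alpha G v w = alpha (npos v) *
    \sum_(i | (0 < v i)%N) (Xv alpha G (vsub v i) w + G (Some (vsub v i, i)) w).
Proof.
rewrite {1}/Xv; case E : (rank v) => [//|n] _ /=; congr (_ * _).
by apply: eq_bigr => i vi; rewrite /Xv; move: E; rewrite (rank_vsub _ _ i) // => -[->].
Qed.

Lemma Xv_ge0 G v w : (forall n, 0 <= alpha n) -> (forall e, 0 <= G e w) ->
  0 <= Xv alpha G v w.
Proof.
move=> a0 G0; elim: {v}(rank v) {-2}v (erefl (rank v)) => [|n IHn] v vn.
  by rewrite Xv_rank0.
rewrite Xv_rec ?vn // mulr_ge0 // sumr_ge0 // => i vi.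
by rewrite addr_ge0 // IHn //; move: vn; rewrite (rank_vsub _ _ i) // => -[].
Qed.

End BroadcastRecursion.

(** The broadcast is linear in the noise: fed with the indicator of one index, on a one-point sample
    space, it returns the coefficient of that index. The coefficients thus inherit the recursion of
    [Xv]. *)
Definition kron {R : realType} d (e : noise_idx d) : noise_idx d -> unit -> R :=
  fun f _ => (f == e)%:R.

Definition noise_coef {R : realType} d (v : vtx d) (e : noise_idx d) : R :=
  Xv alpha_crit (kron d e) v tt.

Definition axis d (k : nat) (i : 'I_d.+1) : vtx d := [ffun j => if j == i then k else 0].

Section NoiseCoefficients.
Variables (R : realType) (d : nat).
Implicit Types (k : nat) (i j : 'I_d.+1) (v : vtx d) (e : noise_idx d).
Local Notation noise_coef := (@noise_coef R d).

Lemma alpha_crit_ge0 n : 0 <= alpha_crit n :> R.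
Proof. by rewrite invr_ge0. Qed.

Lemma noise_coef_ge0 v e : 0 <= noise_coef v e.
Proof. by apply: Xv_ge0 => [|f]; [exact: alpha_crit_ge0 | exact: ler0n]. Qed.

Lemma rank_axis k i : rank (axis d k i) = k.
Proof.
by rewrite /rank (bigD1 i) //= ffunE eqxx big1 ?addn0 // => j /negbTE ji; rewrite ffunE ji.
Qed.

Lemma rank_gt0_npos v : (0 < rank v)%N -> (0 < npos v)%N.
Proof.
rewrite lt0n sum_nat_eq0 => /forall_inPn[i _ vi].
by apply/card_gt0P; exists i; rewrite inE lt0n.
Qed.

(** Criticality enters here: with [alpha_i = 1/i] each vertex averages over the elements it covers,
    so [X_0] is passed on with weight exactly 1. *)
Lemma noise_coef_None v : noise_coef v None = 1.
Proof.
rewrite /noise_coef; elim: {v}(rank v) {-2}v (erefl (rank v)) => [|n IHn] v vn.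
  by rewrite Xv_rank0.
rewrite Xv_rec ?vn // (eq_bigr (fun=> 1)) => [|i vi]; last first.
  rewrite IHn; first by rewrite /kron /= addr0.
  by move: vn; rewrite (rank_vsub _ _ i) // => -[].
rewrite sumr_const mulr_natr -(mulr_natr _^-1).
rewrite mulVf // pnatr_eq0 -lt0n; apply: rank_gt0_npos; rewrite vn //.
Qed.

(** Induction on the rank. At rank [k + 1] only [(k+1) e_i] has a nonzero bound; above it the
    coefficient is the average of its values at the covered elements plus a nonnegative edge term,
    while [corner_bound] is at most its own average. *)
Lemma corner_bound_le_noise_coef k i v : (k < rank v)%N ->
  corner_bound d k i v <= noise_coef v (Some (axis d k i, i)).
Proof.
set e := Some _; move=> kv; have [n vn] : exists n, rank v = (n + k).+1.
  by exists (rank v - k.+1)%N; rewrite -addnS subnK.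
elim: n v vn {kv} => [|n IHn] v vn.
  have [vik|kvi] := leqP (v i) k.
    by rewrite corner_bound_eq0 ?noise_coef_ge0 // vn ltnS.
  have vj j : j != i -> v j = 0.
    move=> ji; apply/eqP; rewrite -leqn0 -(leq_add2l (v i)) addn0.
    rewrite (leq_trans _ kvi) // -vn /rank (bigD1 i) //= leq_add2l.
    by rewrite (bigD1 j) //= leq_addr.
  have vi : v i = k.+1.
    by apply/eqP; rewrite eqn_leq kvi andbT -[X in (_ <= X.+1)%N]add0n -vn leq_coord_rank.
  have ve : vsub v i = axis d k i.
    by apply/ffunP => j; rewrite !ffunE; case: eqVneq => [->|/vj //]; rewrite vi.
  have pos j : (0 < v j)%N = (j == i).
    by case: (eqVneq j i) => [->|/vj ->//]; rewrite vi.
  (* Here [v = (k+1) e_i] covers only [k e_i], so the walk takes this edge surely. *)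
  rewrite (le_trans (corner_bound_le1 _ _ _ _ _)) // /noise_coef Xv_rec ?vn //.
  rewrite (eq_bigl _ _ pos) big_pred1_eq ve /kron eqxx.
  have -> : npos v = 1%N by rewrite /npos (eq_card (_ : _ =i pred1 i)) ?card1 // => j; rewrite !inE pos.
  by rewrite /alpha_crit invr1 mul1r lerDr noise_coef_ge0.
rewrite (le_trans (corner_bound_subharmonic _ _ _ _ _ _)) ?vn ?ltnS ?leq_addl //.
rewrite /noise_coef Xv_rec ?vn // ler_wpM2l ?alpha_crit_ge0 // ler_sum // => j vj.
rewrite -[X in X <= _]addr0 lerD ?ler0n //.
by apply: IHn; move: vn; rewrite (rank_vsub _ _ j) // => -[].
Qed.

(** Linearity over a finite list [J] holding [X_0] and every edge that leaves a rank below [t]. Each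
    such [G f] is itself a combination, with coefficients [kron], so both sides obey the same
    recursion. *)
Lemma Xv_noise_expansion (T : Type) (G : noise_idx d -> T -> R) w
    (J : seq (noise_idx d)) t v :
  uniq J -> None \in J ->
  (forall u i, (rank u < t)%N -> Some (u, i) \in J) -> (rank v <= t)%N ->
  Xv alpha_crit G v w = \sum_(e <- J) noise_coef v e * G e w.
Proof.
move=> uJ J0 JS.
have pick f : f \in J -> G f w = \sum_(e <- J) kron d e f tt * G e w.
  move=> fJ; rewrite (bigD1_seq f) //= /kron eqxx mul1r big1 ?addr0 // => e ef.
  by rewrite eq_sym (negbTE ef) mul0r.
elim: {v}(rank v) {-2}v (erefl (rank v)) => [|n IHn] v vn vt.
  rewrite Xv_rank0 // (pick None) //; apply: eq_bigr => e _.
  by rewrite /noise_coef Xv_rank0.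
rewrite Xv_rec ?vn //.
rewrite [RHS](eq_bigr (fun e => alpha_crit (npos v) * (\sum_(i | (0 < v i)%N)
   (noise_coef (vsub v i) e + kron d e (Some (vsub v i, i)) tt) * G e w))); last first.
  by move=> e _; rewrite /noise_coef Xv_rec ?vn // -mulrA -mulr_suml.
rewrite -mulr_sumr exchange_big /=; congr (_ * _); apply: eq_bigr => i vi.
have vin : rank (vsub v i) = n by move: vn; rewrite (rank_vsub _ _ i) // => -[].
have nt : (n < t)%N by rewrite -vn.
rewrite IHn ?vin 1?ltnW // (pick (Some (vsub v i, i))); last by apply: JS; rewrite vin.
by rewrite -big_split /=; apply: eq_bigr => e _; rewrite mulrDl.
Qed.

End NoiseCoefficients.

(** * Noise mass on the axes *)

Lemma ler_sum_subseq (R : numDomainType) (I : eqType) (s1 s2 : seq I) (F : I -> R) :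
  uniq s1 -> uniq s2 -> {subset s1 <= s2} -> (forall x, 0 <= F x) ->
  \sum_(x <- s1) F x <= \sum_(x <- s2) F x.
Proof.
move=> u1 u2 s12 F0; rewrite [leRHS](bigID (fun x => x \in s1)) /= -[in leRHS]big_filter.
rewrite -[leLHS]addr0 lerD ?sumr_ge0 //.
rewrite (perm_big [seq x <- s2 | x \in s1]) //; apply: uniq_perm => //.
  exact: filter_uniq.
by move=> x; rewrite mem_filter; case: (boolP (x \in s1)) => // /s12 ->.
Qed.

(** Cauchy-Schwarz, by expanding the sum of the squares [(x_i - y / n)^2]. *)
Lemma sqr_sum_le_card (R : realFieldType) (I : finType) (x : I -> R) (y : R) :
  (0 < #|I|)%N -> 0 <= y -> y <= \sum_i x i -> y ^+ 2 / #|I|%:R <= \sum_i x i ^+ 2.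
Proof.
move=> I0 y0 yx; set n : R := #|I|%:R; have n0 : 0 < n by rewrite ltr0n.
have : 0 <= \sum_i (x i - y / n) ^+ 2 by rewrite sumr_ge0 // => i _; rewrite sqr_ge0.
have -> : \sum_i (x i - y / n) ^+ 2 =
    \sum_i x i ^+ 2 - 2 * (y / n) * \sum_i x i + \sum_(i : I) (y / n) ^+ 2.
  rewrite mulr_sumr -sumrB -big_split /=; apply: eq_bigr => i _; ring.
rewrite sumr_const -(mulr_natr (_ ^+ 2)) -/n.
have -> : (y / n) ^+ 2 * n = y ^+ 2 / n by field; lra.
have : 0 <= (y / n) * (\sum_i x i - y) by rewrite mulr_ge0 ?divr_ge0 ?subr_ge0 // ltW.
have -> : y / n * (\sum_i x i - y) = y / n * \sum_i x i - y ^+ 2 / n by field; lra.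
lra.
Qed.

Section SpreadBound.
Variables (R : realType) (d : nat).
Implicit Types (k t : nat) (i j : 'I_d.+1) (v : vtx d).
Let delta : R := 50^-1 ^+ d.

(** Each of the [d] factors is at least 1/50: by antitonicity [v_j] may be raised to [v_i], and
    [L = 4 sqrt v_i] satisfies [40 k <= L] because [100 k^2 <= v_i]. *)
Lemma corner_bound_at_max k i v : (forall j, (v j <= v i)%N) -> (0 < v i)%N ->
  (100 * k ^ 2 <= v i)%N -> delta <= corner_bound d k i v.
Proof.
move=> vmax vi kv; rewrite /delta.
have -> : 50^-1 ^+ d = \prod_(j | j != i) 50^-1 :> R.
  by rewrite prodr_const cardC1 card_ord.
apply: ler_prod => j _; rewrite invr_ge0 ler0n /=.
apply: le_trans (race_antitone _ _ _ _ (vmax j)).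
have v1 : 1 <= (v i)%:R :> R by rewrite ler1n.
set s : R := Num.sqrt (v i)%:R.
have s2 : s ^+ 2 = (v i)%:R by rewrite sqr_sqrtr //; lra.
have s0 : 0 <= s by apply: sqrtr_ge0.
apply: (race_ge_near_diagonal _ (4 * s)); first by nra.
  by rewrite exprMn s2 -natrX.
have : 100 * k%:R ^+ 2 <= s ^+ 2 :> R by rewrite s2 -natrX -natrM ler_nat.
have : 0 <= k%:R :> R by [].
nra.
Qed.

(** A largest coordinate is at least [t / (d+1)], and its term alone suffices. *)
Lemma sum_corner_bound_ge k t v : rank v = t -> (0 < t)%N ->
  (100 * d.+1 * k ^ 2 <= t)%N -> delta <= \sum_i corner_bound d k i v.
Proof.
move=> vt t0 kt.
have [i vmax] : exists i, forall j, (v j <= v i)%N.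
  by exists [arg max_(i > ord0) v i]; case: arg_maxnP => // i _ im j; apply: im.
have tv : (t <= d.+1 * v i)%N.
  have : (\sum_(j < d.+1) v j <= \sum_(j < d.+1) v i)%N by apply: leq_sum.
  by rewrite sum_nat_const card_ord -vt.
rewrite (bigD1 i) //= -[delta]addr0 lerD ?sumr_ge0 // => [|j _]; last exact: corner_bound_ge0.
apply: corner_bound_at_max => //; first by case: (v i) tv => //; lia.
by rewrite -(leq_pmul2l (ltn0Sn d)); lia.
Qed.

Lemma noise_coef_sqr_sum_ge t (c : vtx d -> R) (J : seq (noise_idx d)) :
  (0 < t)%N -> (forall u, u \in layer d t -> 0 <= c u) -> uniq J ->
  (forall u i, (rank u < t)%N -> Some (u, i) \in J) ->
  delta ^+ 2 / (10 * d.+1%:R * Num.sqrt d.+1%:R) * Num.sqrt t%:R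
      * (\sum_(u <- layer d t) c u) ^+ 2
    <= \sum_(e <- J) (\sum_(u <- layer d t) c u * noise_coef d u e) ^+ 2.
Proof.
move=> t0 c0 uJ JS; set C := \sum_(u <- _) c u.
pose a e : R := \sum_(u <- layer d t) c u * noise_coef d u e.
have delta0 : 0 <= delta by rewrite exprn_ge0.
have C0 : 0 <= C by rewrite /C big_seq sumr_ge0.
(* The favoured axis depends on [u], so the mass [delta * C] is bounded below only for the sum over
   [i]; Cauchy-Schwarz then costs a factor [d + 1]. *)
have level k : (100 * d.+1 * k ^ 2 <= t)%N ->
    (delta * C) ^+ 2 / d.+1%:R <= \sum_i a (Some (axis d k i, i)) ^+ 2.
  move=> kt; rewrite -[d.+1 in X in X <= _]card_ord.
  apply: sqr_sum_le_card; rewrite ?card_ord ?mulr_ge0 //.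
  rewrite /a exchange_big /= /C mulr_sumr big_seq [leRHS]big_seq.
  apply: ler_sum => u ut; rewrite -mulr_sumr mulrC ler_wpM2l ?c0 //.
  move: ut; rewrite mem_layer => /eqP ut.
  apply: (le_trans (sum_corner_bound_ge k t u _ _ _)) => //.
  apply: ler_sum => i _; apply: corner_bound_le_noise_coef; rewrite ut; nia.
(* [x] solves [100 (d+1) x^2 = t], so the levels [0, ..., truncn x] are all admissible and their
   number [n] is at least [x]. *)
pose x : R := Num.sqrt t%:R / (10 * Num.sqrt d.+1%:R).
have sd0 : 0 < Num.sqrt d.+1%:R :> R by rewrite sqrtr_gt0.
have x0 : 0 <= x by rewrite divr_ge0 ?sqrtr_ge0 // mulr_ge0 // ltW.
pose n := (Num.truncn x).+1.
have xn : x <= n%:R by rewrite ltW // truncnS_gt.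
have kn k : (k < n)%N -> (100 * d.+1 * k ^ 2 <= t)%N.
  rewrite ltnS => kx; have : k%:R <= x.
    by have /andP[nx _] := truncn_itv x0; rewrite (le_trans _ nx) ?ler_nat.
  rewrite /x ler_pdivlMr ?mulr_gt0 // => h.
  rewrite -(ler_nat R) natrM natrX.
  have <- : (Num.sqrt t%:R) ^+ 2 = t%:R :> R by rewrite sqr_sqrtr.
  have e : (Num.sqrt d.+1%:R) ^+ 2 = d.+1%:R :> R by rewrite sqr_sqrtr.
  rewrite natrM -e.
  have -> : 100%:R * Num.sqrt d.+1%:R ^+ 2 * k%:R ^+ 2 =
    (k%:R * (10 * Num.sqrt d.+1%:R)) ^+ 2 :> R by ring.
  by rewrite ler_pXn2r // nnegrE ?sqrtr_ge0 // mulr_ge0 // mulr_ge0 // ltW.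
pose corners : seq (noise_idx d) :=
  [seq Some (axis d k i, i) | k <- iota 0 n, i <- enum 'I_d.+1].
have ucorners : uniq corners.
  apply: allpairs_uniq; rewrite ?iota_uniq ?enum_uniq // => -[k i] [l j] _ _ /= [kl ij].
  by rewrite -(rank_axis d k i) kl rank_axis ij.
apply: (@le_trans _ _ (\sum_(e <- corners) a e ^+ 2)); last first.
  apply: ler_sum_subseq => // [e|e]; last exact: sqr_ge0.
  case/allpairsP => -[k i] []; rewrite mem_iota add0n => /andP[_ /= kn'] _ ->.
  by apply: JS; rewrite rank_axis; move/kn: kn'; nia.
rewrite big_allpairs_dep /=.
apply: (@le_trans _ _ (\sum_(k <- iota 0 n) (delta * C) ^+ 2 / d.+1%:R)); last first.
  rewrite big_seq [leRHS]big_seq; apply: ler_sum => k; rewrite mem_iota add0n => /= kn'.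
  by rewrite big_enum; apply: level; apply: kn.
rewrite big_const_seq count_predT size_iota iter_addr addr0 -[leRHS]mulr_natr.
apply: (@le_trans _ _ ((delta * C) ^+ 2 / d.+1%:R * x)); last first.
  by rewrite ler_wpM2l // mulr_ge0 ?sqr_ge0 ?invr_ge0.
rewrite le_eqVlt; apply/orP; left; apply/eqP; rewrite /x; field.
by rewrite gt_eqF //= addrC natr1 gt_eqF.
Qed.
End SpreadBound.

(** * Second moment of the normal law *)

Section Density.
Context d (T : measurableType d) (R : realType).
Variables (nu : {finite_measure set T -> \bar R}) (mu : {sigma_finite_measure set T -> \bar R}).
Variable p : T -> R.
Hypothesis ip : mu.-integrable setT (EFin \o p).
Hypothesis nuE : forall A, measurable A -> nu A = (\int[mu]_(x in A) (p x)%:E)%E.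

(** The Radon-Nikodym derivative of [nu] agrees with [p] almost everywhere, both having the same
    integral over every measurable set. *)
Lemma ge0_integral_density (f : T -> \bar R) :
  measurable_fun setT f -> (forall x, 0 <= f x)%E ->
  (\int[nu]_x f x = \int[mu]_x (f x * (p x)%:E))%E.
Proof.
move=> mf f0.
have numu : nu `<< mu.
  apply/null_content_dominatesP => A mA muA0; rewrite nuE //.
  apply: null_set_integral => //; apply: measurable_funTS; exact: measurable_int ip.
rewrite -(Radon_Nikodym_SigmaFinite.change_of_variables numu) //.
have mRN := measurable_int _ (Radon_Nikodym_SigmaFinite.f_integrable numu).
apply: ae_eq_integral => //.
- exact: emeasurable_funM.
- by apply: emeasurable_funM => //; exact: measurable_int ip.
- apply: ae_eqe_mul2l; apply: integral_ae_eq => //.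
  + exact: Radon_Nikodym_SigmaFinite.f_integrable.
  + exact: measurable_int ip.
  + by move=> A _ mA; rewrite -Radon_Nikodym_SigmaFinite.f_integral // nuE.
Qed.

End Density.

(** From [x^2 / 4 <= exp (x^2 / 4)]: half of the Gaussian decay absorbs the square, leaving a
    multiple of the normal density of variance 2. *)
Lemma sqr_normal_pdf_le (R : realType) (x : R) :
  x ^+ 2 * normal_pdf 0 1 x <=
    4 * normal_peak 1 / normal_peak (Num.sqrt 2) * normal_pdf 0 (Num.sqrt 2) x.
Proof.
have s2 : Num.sqrt 2 != 0 :> R by rewrite gt_eqF // sqrtr_gt0.
rewrite !normal_pdfE ?oner_eq0 // [normal_peak (Num.sqrt 2) * _]mulrC.
rewrite -[leRHS]mulrA [_^-1 * _]mulrC mulfK ?gt_eqF ?normal_peak_gt0 //.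
rewrite mulrCA -[leRHS]mulrA [leRHS]mulrCA ler_wpM2l ?normal_peak_ge0 //.
rewrite /normal_fun subr0 expr1n sqr_sqrtr //.
set u := expR (x ^+ 2 / 4).
have u0 : 0 < u by apply: expR_gt0.
have xu : x ^+ 2 <= 4 * u.
  have : 1 + x ^+ 2 / 4 <= u by apply: expR_ge1Dx.
  lra.
have -> : expR (- x ^+ 2 / (2 *+ 2)) = u^-1.
  by rewrite -expRN; congr expR; field.
have -> : expR (- x ^+ 2 / (1 *+ 2)) = u^-1 * u^-1.
  by rewrite -expRN -expRD; congr expR; field.
by rewrite mulrA ler_pM2r ?invr_gt0 // ler_pdivrMr.
Qed.

Lemma normal_sqr_integrable (R : realType) :
  (\int[normal_prob (0 : R) 1]_x (x ^+ 2)%:E < +oo)%E.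
Proof.
have mpdf (s : R) : measurable_fun setT (fun x : measurableTypeR R => (normal_pdf 0 s x)%:E).
  apply/measurable_EFinP. exact: measurable_normal_pdf.
have msqr : measurable_fun setT (fun x : measurableTypeR R => (x ^+ 2)%:E).
  by apply/measurable_EFinP; exact: measurable_funX.
rewrite (ge0_integral_density _ _ _ _ lebesgue_measure (normal_pdf 0 1)) //=.
- apply: (@le_lt_trans _ _ (\int[lebesgue_measure]_x
    ((4 * normal_peak 1 / normal_peak (Num.sqrt 2))%:E * (normal_pdf 0 (Num.sqrt 2) x)%:E))%E).
    apply: ge0_le_integral => //.
    + by move=> x _; rewrite mule_ge0 // lee_fin ?sqr_ge0 // normal_pdf_ge0.
    + exact: emeasurable_funM.
    + exact: emeasurable_funM.
    + by move=> x _; rewrite -!EFinM lee_fin sqr_normal_pdf_le.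
  rewrite integralZl //; last exact: integrable_normal_pdf.
  by rewrite integral_normal_pdf mule1 ltry.
- exact: integrable_normal_pdf.
- by move=> x; rewrite lee_fin sqr_ge0.
Qed.

(** * Covariances *)

Section Independence.
Context d (T : measurableType d) (R : realType) (P : probability T R).
Implicit Types X Y : T -> R.

Lemma Lfun2_of_sqr X : measurable_fun setT X ->
  (\int[P]_w ((X w) ^+ 2)%:E < +oo)%E -> X \in Lfun P 2%:E.
Proof.
move=> mX X2; rewrite inE; apply/andP; split; rewrite inE //=.
rewrite /finite_norm unlock /Lnorm poweR_lty //.
rewrite (le_lt_trans _ X2) // le_eqVlt; apply/orP; left; apply/eqP.
by apply: eq_integral => w _; rewrite /= powR_mulrn // real_normK ?num_real.
Qed.

Lemma Lfun2_Lfun1 X : X \in Lfun P 2%:E -> X \in Lfun P 1.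
Proof. by apply: Lfun_subset12; rewrite fin_num_measure. Qed.

(** By uniqueness of the product measure the joint law is the product of the marginals; Fubini then
    factors the integral. *)
Lemma expectationM_indep X Y : measurable_fun setT X -> measurable_fun setT Y ->
  (forall A B, measurable A -> measurable B ->
    P (X @^-1` A `&` Y @^-1` B) = P (X @^-1` A) * P (Y @^-1` B))%E ->
  X \in Lfun P 1 -> Y \in Lfun P 1 -> (X * Y) \in Lfun P 1 ->
  ('E_P[X * Y] = 'E_P[X] * 'E_P[Y])%E.
Proof.
move=> mX mY XY X1 Y1 XY1.
pose X' : {mfun T >-> R} := HB.pack X (isMeasurableFun.Build _ _ _ _ _ mX).
pose Y' : {mfun T >-> R} := HB.pack Y (isMeasurableFun.Build _ _ _ _ _ mY).
have mZ : measurable_fun setT (fun w => (X w, Y w)) by exact/measurable_fun_pairP.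
pose Z' : {mfun T >-> (R * R)%type} := HB.pack (fun w => (X w, Y w)) (isMeasurableFun.Build _ _ _ _ _ mZ).
pose m1 := distribution P X'; pose m2 := distribution P Y'.
have prodE A : measurable A -> (m1 \x m2)%E A = distribution P Z' A.
  by apply: product_measure_unique => B C mB mC; rewrite -XY.
pose f (z : R * R) := (z.1 * z.2)%:E.
have mf : measurable_fun setT f.
  apply/measurable_EFinP; apply: measurable_funM; [exact: measurable_fst|exact: measurable_snd].
have iXY : P.-integrable setT (f \o Z').
  by apply/Lfun1_integrable.
have if' : (m1 \x m2)%E.-integrable setT f.
  have /integrableP[_ h] := integrable_pushforward mZ mf iXY measurableT.
  apply/integrableP; split => //; apply: le_lt_trans h.
  rewrite le_eqVlt; apply/orP; left; apply/eqP; apply: eq_measure_integral => A mA _.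
  exact: prodE.
have -> : ('E_P[X * Y] = \int[distribution P Z']_z f z)%E.
  by rewrite integral_distribution // unlock.
rewrite (@eq_measure_integral _ _ _ _ (m1 \x m2)%E) => [|A mA _]; last exact/esym/prodE.
rewrite -integral12_prod_meas1 // /fubini_F /f /=.
have Y1' : m2.-integrable setT (EFin : R -> \bar R).
  apply: (integrable_pushforward mY) => //; exact/Lfun1_integrable.
have X1' : m1.-integrable setT (EFin : R -> \bar R).
  apply: (integrable_pushforward mX) => //; exact/Lfun1_integrable.
have EY : (\int[m2]_y y%:E = 'E_P[Y])%E.
  rewrite /m2 integral_distribution //; first by rewrite unlock.
  exact/Lfun1_integrable.
have EX : (\int[m1]_x x%:E = 'E_P[X])%E.
  rewrite /m1 integral_distribution //; first by rewrite unlock.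
  exact/Lfun1_integrable.
under eq_integral => x _.
  under eq_integral do rewrite EFinM.
  rewrite integralZl // EY -(fineK (expectation_fin_num Y1)).
  over.
by rewrite integralZr // EX fineK // expectation_fin_num.
Qed.

Lemma covariance_indep X Y : measurable_fun setT X -> measurable_fun setT Y ->
  (forall A B, measurable A -> measurable B ->
    P (X @^-1` A `&` Y @^-1` B) = P (X @^-1` A) * P (Y @^-1` B))%E ->
  X \in Lfun P 2%:E -> Y \in Lfun P 2%:E -> (covariance P X Y = 0)%E.
Proof.
move=> mX mY XY X2 Y2; have XY1 := Lfun2_mul_Lfun1 X2 Y2.
have X1 := Lfun2_Lfun1 _ X2; have Y1 := Lfun2_Lfun1 _ Y2.
rewrite covarianceE // expectationM_indep // subee //.
by rewrite fin_numM // expectation_fin_num.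
Qed.

End Independence.

Section UncorrelatedFamily.
Context dsp (T : measurableType dsp) (R : realType) (P : probability T R).
Variables (I : eqType) (G : I -> T -> R).
Hypothesis G2 : forall i, G i \in Lfun P 2%:E.
Implicit Types (J : seq I) (a : I -> R) (Y : T -> R).

Lemma lincomb_cons i J a :
  (fun w => \sum_(e <- i :: J) a e * G e w) =
  (a i \o* G i) \+ (fun w => \sum_(e <- J) a e * G e w).
Proof. by apply/funext => w; rewrite big_cons /= mulrC. Qed.

Lemma Lfun2_lincomb J a : (fun w => \sum_(e <- J) a e * G e w) \in Lfun P 2%:E.
Proof.
elim: J => [|i J IHJ].
  rewrite (_ : (fun w => _) = cst 0) ?Lfun_cst //.
  by apply/funext => w; rewrite big_nil.
by rewrite lincomb_cons rpredD ?lee1n //= Lfun_scale ?ler1n.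
Qed.

Lemma covariance_lincombl J a Y : Y \in Lfun P 2%:E ->
  (covariance P (fun w => \sum_(e <- J) a e * G e w)%R Y =
   \sum_(e <- J) (a e)%:E * covariance P (G e) Y)%E.
Proof.
move=> Y2; elim: J => [|i J IHJ].
  rewrite big_nil (_ : (fun w => _) = cst 0) ?covariance_cst_l //.
  by apply/funext => w; rewrite big_nil.
rewrite lincomb_cons big_cons -IHJ covarianceDl ?Lfun_scale ?ler1n ?Lfun2_lincomb //.
by rewrite covarianceZl ?Lfun2_mul_Lfun1 ?Lfun2_Lfun1.
Qed.

Variable s2 : R.
Hypothesis covG : forall i j, covariance P (G i) (G j) = (s2 * (i == j)%:R)%:E.

Lemma covariance_lincomb_memr J a i : uniq J -> i \in J ->
  covariance P (fun w => \sum_(e <- J) a e * G e w) (G i) = (s2 * a i)%:E.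
Proof.
move=> uJ iJ; rewrite covariance_lincombl // (bigD1_seq i) //= big1 ?adde0.
  by rewrite covG eqxx mulr1 -EFinM mulrC.
by move=> e ei; rewrite covG (negbTE ei) mulr0 mule0.
Qed.

Lemma variance_lincomb J a : uniq J ->
  'V_P[fun w => \sum_(e <- J) a e * G e w] = (s2 * \sum_(e <- J) a e ^+ 2)%:E.
Proof.
move=> uJ; rewrite /variance covariance_lincombl ?Lfun2_lincomb //.
rewrite mulr_sumr -sumEFin big_seq [RHS]big_seq; apply: eq_bigr => e eJ.
by rewrite covarianceC covariance_lincomb_memr // -EFinM mulrCA expr2.
Qed.

End UncorrelatedFamily.

(** Expressed through the law alone, so that the final constant can be fixed before the probability
    space and the noise. *)
Definition std_normal_var (R : realType) : R :=
  fine (\int[normal_prob (0 : R) 1]_x (x ^+ 2)%:E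
        - (\int[normal_prob (0 : R) 1]_x x%:E) ^+ 2)%E.

Section StdNormal.
Context dsp (T : measurableType dsp) (R : realType) (P : probability T R).
Implicit Types X Y : T -> R.

Lemma std_normal_Lfun2 X : std_normal P X -> X \in Lfun P 2%:E.
Proof.
move=> [mX XE]; apply: Lfun2_of_sqr => //.
pose X' : {mfun T >-> measurableTypeR R} :=
  HB.pack (X : T -> measurableTypeR R) (isMeasurableFun.Build _ _ T (measurableTypeR R) _ mX).
have := normal_sqr_integrable R; congr (_ < _)%E.
rewrite -(ge0_integral_distribution (P := P) X' (f := fun x : measurableTypeR R => (x ^+ 2)%:E)) //.
- by apply: eq_measure_integral => A mA _; exact/esym/XE.
- by apply/measurable_EFinP; exact: measurable_funX.
- by move=> y; rewrite lee_fin sqr_ge0.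
Qed.

Lemma std_normal_variance X : std_normal P X -> 'V_P[X] = (std_normal_var R)%:E.
Proof.
move=> XN; have X2 := std_normal_Lfun2 _ XN; have [mX XE] := XN.
rewrite -[LHS]fineK ?variance_fin_num // varianceE // /std_normal_var.
pose X' : {mfun T >-> measurableTypeR R} :=
  HB.pack (X : T -> measurableTypeR R) (isMeasurableFun.Build _ _ T (measurableTypeR R) _ mX).
congr (fine (_ - _ ^+ 2))%:E.
- rewrite unlock -(ge0_integral_distribution (P := P) X' (f := fun x : measurableTypeR R => (x ^+ 2)%:E)) //.
  + by apply: eq_measure_integral => A mA _; exact: XE.
  + by apply/measurable_EFinP; exact: measurable_funX.
  + by move=> y; rewrite lee_fin sqr_ge0.
- rewrite unlock -(integral_distribution (P := P) (X := X') (f := fun x : measurableTypeR R => x%:E)) //.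
  + by apply: eq_measure_integral => A mA _; exact: XE.
  + by apply/measurable_EFinP; exact: measurable_id.
  + by have /Lfun1_integrable := Lfun2_Lfun1 _ _ _ _ _ X2.
Qed.

Lemma covariance_std_normal_family (I : eqType) (G : I -> T -> R) i j :
  (forall k, std_normal P (G k)) -> mutually_independent P G ->
  covariance P (G i) (G j) = (std_normal_var R * (i == j)%:R)%:E.
Proof.
move=> GN GI; have [<-|ij] := eqVneq i j.
  by rewrite mulr1; apply: std_normal_variance.
rewrite mulr0; apply: covariance_indep; try exact: (GN _).1; try exact: std_normal_Lfun2.
move=> A B mA mB.
have := GI [:: i; j] (fun k => if k == i then A else B).
rewrite !big_cons !big_nil eqxx eq_sym (negbTE ij) setIT mule1; apply.
  by rewrite /= inE ij.
by move=> k; case: ifP.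
Qed.

End StdNormal.

(** * The correlation bound *)

Theorem mainTheorem3 (R : realType) (d : nat) :
  exists K : R, 0 < K /\
  forall (dsp : measure_display) (T : measurableType dsp) (P : probability T R)
         (G : noise_idx d -> T -> R),
    (forall j, std_normal P (G j)) ->
    mutually_independent P G ->
    forall (t : nat) (c : vtx d -> R),
      (1 <= t)%N ->
      (forall u, u \in layer d t -> 0 <= c u) ->
      0 < \sum_(u <- layer d t) c u ->
      let zeta := fun w => \sum_(u <- layer d t) c u * Xv alpha_crit G u w in
      fine (covariance P zeta (G None)) / Num.sqrt (fine ('V_P[zeta]))
        <= K / (t%:R `^ (4%:R)^-1).
Proof.
pose kappa : R := (50^-1 ^+ d) ^+ 2 / (10 * d.+1%:R * Num.sqrt d.+1%:R).
have kappa0 : 0 < kappa.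
  by rewrite divr_gt0 ?exprn_gt0 ?mulr_gt0 ?sqrtr_gt0.
pose s2 : R := std_normal_var R.
(* The covariance is [s2 * C] and the standard deviation at least
   [sqrt s2 * sqrt kappa * t^(1/4) * C]; their quotient gives the first term. The added 1 keeps the
   constant positive should [s2] be 0. *)
exists (Num.sqrt s2 / Num.sqrt kappa + 1); split.
  by rewrite ltr_wpDl // divr_ge0 ?sqrtr_ge0.
move=> dsp T P G GN GI t c t0 c0 C0; set zeta := fun w => _; cbv zeta.
pose C := \sum_(u <- layer d t) c u; rewrite -/C in C0.
(* [X_0] and all edges leaving ranks below [t]: every noise variable on which [zeta] depends. *)
pose J : seq (noise_idx d) := undup (None ::
  [seq Some e | e <- [seq (u, i) | u <- flatten [seq layer d s | s <- iota 0 t],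
                                   i <- enum 'I_d.+1]]).
have uJ : uniq J := undup_uniq _.
have J0 : None \in J by rewrite mem_undup mem_head.
have JS u i : (rank u < t)%N -> Some (u, i) \in J.
  move=> ut; rewrite mem_undup inE /=; apply: map_f; apply/allpairsP; exists (u, i).
  rewrite mem_enum; split => //=; apply/flatten_mapP; exists (rank u).
    by rewrite mem_iota.
  by rewrite mem_layer.
pose a e : R := \sum_(u <- layer d t) c u * noise_coef d u e.
have zetaE : zeta = fun w => \sum_(e <- J) a e * G e w.
  apply/funext => w; rewrite /zeta.
  under [RHS]eq_bigr do rewrite mulr_suml.
  rewrite exchange_big /= big_seq [RHS]big_seq; apply: eq_bigr => u.
  rewrite mem_layer => /eqP ut; rewrite (Xv_noise_expansion _ _ _ _ _ J t) ?ut //.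
  by rewrite mulr_sumr; apply: eq_bigr => e _; rewrite mulrA.
have G2 e : G e \in Lfun P 2%:E by apply: std_normal_Lfun2.
have covG e f : covariance P (G e) (G f) = (s2 * (e == f)%:R)%:E.
  exact: covariance_std_normal_family.
have aC : a None = C by apply: eq_bigr => u _; rewrite noise_coef_None mulr1.
rewrite zetaE (covariance_lincomb_memr _ _ _ _ _ _ G2 s2) //.
rewrite (variance_lincomb _ _ _ _ _ _ G2 s2) //= aC.
set A := \sum_(e <- J) _.
have s2_ge0 : 0 <= s2.
  by rewrite -lee_fin /s2 -(std_normal_variance _ _ _ P _ (GN None)) variance_ge0.
(* [A] is at least of order [sqrt t], and the standard deviation takes one more root, hence the
   exponent 1/4. *)
have tE : Num.sqrt t%:R = (t%:R `^ 4^-1) ^+ 2 :> R.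
  by rewrite -powR12_sqrt // -powR_mulrn ?powR_ge0 // -powRrM; congr powR; field.
set x : R := t%:R `^ _ in tE *.
have x0 : 0 < x by rewrite powR_gt0 // ltr0n.
have hA : kappa * x ^+ 2 * C ^+ 2 <= A.
  by rewrite -tE; apply: noise_coef_sqr_sum_ge.
have hD : Num.sqrt s2 * (Num.sqrt kappa * x * C) <= Num.sqrt (s2 * A).
  rewrite [leRHS]sqrtrM //; apply: ler_wpM2l; first exact: sqrtr_ge0.
  have y0 : 0 <= Num.sqrt kappa * x * C by rewrite !mulr_ge0 ?sqrtr_ge0 // ltW.
  rewrite -(ger0_norm y0) -sqrtr_sqr; apply: ler_wsqrtr.
  by rewrite !exprMn sqr_sqrtr // ltW.
(* For [s2 = 0] the covariance, hence the left side, is 0. *)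
have [s20|s2N] := eqVneq s2 0.
  rewrite s20 !mul0r sqrtr0 mul0r add0r; apply: divr_ge0 => //; exact: ltW.
have s2p : 0 < s2 by rewrite lt_def s2N.
have D0 : 0 < Num.sqrt s2 * (Num.sqrt kappa * x * C).
  by rewrite !mulr_gt0 ?sqrtr_gt0.
rewrite ler_pdivrMr ?(lt_le_trans D0) //.
apply: (@le_trans _ _ (Num.sqrt s2 / Num.sqrt kappa / x
    * (Num.sqrt s2 * (Num.sqrt kappa * x * C)))).
  rewrite -[X in X * C <= _](sqr_sqrtr s2_ge0) le_eqVlt; apply/orP; left; apply/eqP.
  by field; rewrite !gt_eqF ?sqrtr_gt0.
apply: ler_pM => //; first by rewrite !mulr_ge0 ?invr_ge0 ?sqrtr_ge0 // ltW.
  exact: ltW.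
by rewrite ler_pM2r ?invr_gt0 // lerDl.
Qed.
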